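(* The set $\mathcal F(\mathbb H)$ is a right quaternionic Hilbert space of Cauchy-Fueter regular functions, whose reproducing kernel is given by $$K_{\mathcal F(\mathbb H)}(q,p)=\sum_{k=0}^\infty\frac{Q_k(q)\overline{Q_k(p)}}{k!},\qquad (q,p)\in\mathbb H\times\mathbb H.$$ Moreover, if $\psi_k(q)=\frac{Q_k(q)}{\sqrt{k!}}$ for $k\ge 0$, then the family $\{\psi_k\}_{k\ge 0}$ forms an orthonormal basis of $\mathcal F(\mathbb H)$.
   Context: $\mathbb H$ denotes the quaternions, with conjugate $\overline q$ and modulus $|q|$. For $k\ge 0$, $Q_k(q)=\sum_{j=0}^k T^k_j\,q^{k-j}\overline q^{\,j}$ with $T^k_j=\frac{2(k-j+1)}{(k+1)(k+2)}$. The Clifford-Appell Fock space is $$\mathcal F(\mathbb H)=\left\{\sum_{k=0}^\infty Q_k\alpha_k:\ \alpha_k\in\mathbb H,\ \sum_{k=0}^\infty k!\,|\alpha_k|^2<\infty\right\},$$ a set of functions on $\mathbb H$, with scalar product $\langle f,g\rangle_{\mathcal F(\mathbb H)}=\sum_{k=0}^\infty k!\,\overline{\alpha_k}\beta_k$ for $f=\sum Q_k\alpha_k$, $g=\sum Q_k\beta_k$. (Cauchy-)Fueter regular means real differentiable with $\left(\frac{\partial}{\partial x_0}+i\frac{\partial}{\partial x_1}+j\frac{\partial}{\partial x_2}+k\frac{\partial}{\partial x_3}\right)f=0$. The reproducing property reads $\langle K(\cdot,p),f\rangle_{\mathcal F(\mathbb H)}=f(p)$ for all $f\in\mathcal F(\mathbb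 H)$ and $p\in\mathbb H$, with $K(\cdot,p)\in\mathcal F(\mathbb H)$. *)

(* Defs.v *)
From HB Require Import structures.
From mathcomp Require Import all_boot all_order all_algebra.
From mathcomp Require Import all_classical all_reals all_analysis.
From mathcomp Require Import ring.
Set Implicit Arguments.
Unset Strict Implicit.
Unset Printing Implicit Defensive.
Import Order.TTheory GRing.Theory Num.Theory.
Import numFieldNormedType.Exports.
Local Open Scope classical_set_scope.
Local Open Scope ring_scope.

(* The row (x0, x1, x2, x3) stands for x0 + i x1 + j x2 + k x3.  The normed
   space structure is inherited from row vectors: `|q| is the sup norm, which
   only serves to give the topology (limits, differentiability) of R^4.  The
   Euclidean modulus is qabs below. *)
Definition quat (R : realType) : Type := 'rV[R]_4.

HB.instance Definition _ (R : realType) :=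
  NormedModule.copy (quat R) 'rV[R]_4.
HB.instance Definition _ (R : realType) := Complete.copy (quat R) 'rV[R]_4.
HB.instance Definition _ (R : realType) := Vector.copy (quat R) 'rV[R]_4.

Definition qc0 (R : realType) (q : quat R) : R := (q : 'rV[R]_4) 0 0.
Definition qc1 (R : realType) (q : quat R) : R := (q : 'rV[R]_4) 0 1.
Definition qc2 (R : realType) (q : quat R) : R := (q : 'rV[R]_4) 0 2.
Definition qc3 (R : realType) (q : quat R) : R := (q : 'rV[R]_4) 0 3.

Definition quat_of (R : realType) (a b c d : R) : quat R :=
  \row_(i < 4) [:: a; b; c; d]`_i.

Section QuaternionRing.
Variable R : realType.
Implicit Types p q r : quat R.

Definition qmul p q : quat R := quat_of
  (qc0 p * qc0 q - qc1 p * qc1 q - qc2 p * qc2 q - qc3 p * qc3 q)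
  (qc0 p * qc1 q + qc1 p * qc0 q + qc2 p * qc3 q - qc3 p * qc2 q)
  (qc0 p * qc2 q - qc1 p * qc3 q + qc2 p * qc0 q + qc3 p * qc1 q)
  (qc0 p * qc3 q + qc1 p * qc2 q - qc2 p * qc1 q + qc3 p * qc0 q).

Definition qone : quat R := quat_of 1 0 0 0.

Lemma quat_eqP p q :
  [/\ qc0 p = qc0 q, qc1 p = qc1 q, qc2 p = qc2 q & qc3 p = qc3 q] -> p = q.
Proof.
move=> [h0 h1 h2 h3]; apply/matrixP => i j; rewrite (ord1 i).
case: j => -[|[|[|[|//]]]] lt_j4.
- by move: h0; congr (p _ _ = q _ _); exact: val_inj.
- by move: h1; congr (p _ _ = q _ _); exact: val_inj.
- by move: h2; congr (p _ _ = q _ _); exact: val_inj.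
- by move: h3; congr (p _ _ = q _ _); exact: val_inj.
Qed.

Lemma quat_ofE (a b c d : R) :
  (qc0 (quat_of a b c d) = a) * (qc1 (quat_of a b c d) = b) *
  (qc2 (quat_of a b c d) = c) * (qc3 (quat_of a b c d) = d).
Proof. by rewrite /qc0 /qc1 /qc2 /qc3 !mxE. Qed.

Lemma quat_coordD p q :
  (qc0 (p + q) = qc0 p + qc0 q) * (qc1 (p + q) = qc1 p + qc1 q) *
  (qc2 (p + q) = qc2 p + qc2 q) * (qc3 (p + q) = qc3 p + qc3 q).
Proof. by do !split; exact: mxE. Qed.

Lemma quat_coordZ (a : R) p :
  (qc0 (a *: p) = a * qc0 p) * (qc1 (a *: p) = a * qc1 p) *
  (qc2 (a *: p) = a * qc2 p) * (qc3 (a *: p) = a * qc3 p).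
Proof. by do !split; exact: mxE. Qed.

Fact qmulA : associative qmul.
Proof. by move=> p q r; apply: quat_eqP; rewrite !quat_ofE; split; ring. Qed.

Fact qmul1q : left_id qone qmul.
Proof. by move=> q; apply: quat_eqP; rewrite !quat_ofE; split; ring. Qed.

Fact qmulq1 : right_id qone qmul.
Proof. by move=> q; apply: quat_eqP; rewrite !quat_ofE; split; ring. Qed.

Fact qmulDl : left_distributive qmul +%R.
Proof.
by move=> p q r; apply: quat_eqP; rewrite !(quat_ofE, quat_coordD); split; ring.
Qed.

Fact qmulDr : right_distributive qmul +%R.
Proof.
by move=> p q r; apply: quat_eqP; rewrite !(quat_ofE, quat_coordD); split; ring.
Qed.

Fact qone_neq0 : qone != 0.
Proof.
apply/eqP => /(congr1 (@qc0 R)).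
by rewrite quat_ofE /qc0 mxE => /eqP; rewrite oner_eq0.
Qed.

End QuaternionRing.

HB.instance Definition _ (R : realType) := GRing.Zmodule_isNzRing.Build (quat R)
  (@qmulA R) (@qmul1q R) (@qmulq1 R) (@qmulDl R) (@qmulDr R) (@qone_neq0 R).

Fact quat_scaleAl (R : realType) (a : R) (p q : quat R) :
  a *: (p * q) = (a *: p) * q.
Proof.
by apply: quat_eqP; rewrite !(quat_ofE, quat_coordZ); split; ring.
Qed.

HB.instance Definition _ (R : realType) :=
  GRing.Lmodule_isLalgebra.Build R (quat R) (@quat_scaleAl R).

Fact quat_scaleAr (R : realType) (a : R) (p q : quat R) :
  a *: (p * q) = p * (a *: q).
Proof.
by apply: quat_eqP; rewrite !(quat_ofE, quat_coordZ); split; ring.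
Qed.

HB.instance Definition _ (R : realType) :=
  GRing.Lalgebra_isAlgebra.Build R (quat R) (@quat_scaleAr R).

Section Quaternions.
Variable R : realType.
Implicit Types p q : quat R.

Definition qi : quat R := quat_of 0 1 0 0.
Definition qj : quat R := quat_of 0 0 1 0.
Definition qk : quat R := quat_of 0 0 0 1.

Definition qconj q : quat R := quat_of (qc0 q) (- qc1 q) (- qc2 q) (- qc3 q).

Definition qabs q : R :=
  Num.sqrt (qc0 q ^+ 2 + qc1 q ^+ 2 + qc2 q ^+ 2 + qc3 q ^+ 2).

(* The partial derivatives along x0, x1, x2, x3 are the directional derivatives
   along 1, i, j, k; the imaginary units multiply on the left. *)
Definition fueter_op (f : quat R -> quat R) q : quat R :=
  'D_1 f q + qi * 'D_qi f q + qj * 'D_qj f q + qk * 'D_qk f q.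

Definition fueter_regular (f : quat R -> quat R) : Prop :=
  forall q, differentiable f q /\ fueter_op f q = 0.

End Quaternions.

Section RightHilbert.
Variables (R : realType) (V : zmodType).

Definition ip_norm (ip : V -> V -> quat R) (f : V) : R :=
  Num.sqrt (qc0 (ip f f)).

(* H, a subset of the additive group V, is a right quaternionic Hilbert space
   for the right scalar multiplication rscale and the scalar product ip, which
   is right linear in its second argument. *)
Record right_hilbert (rscale : V -> quat R -> V) (ip : V -> V -> quat R)
    (H : set V) : Prop := RightHilbert {
  rh_0 : H 0;
  rh_add : forall f g, H f -> H g -> H (f + g);
  rh_opp : forall f, H f -> H (- f);
  rh_scale : forall f a, H f -> H (rscale f a);
  rh_scale1 : forall f, H f -> rscale f 1 = f;
  rh_scaleM : forall f a b, H f -> rscale f (a * b) = rscale (rscale f a) b;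
  rh_scaleDl : forall f g a, H f -> H g ->
    rscale (f + g) a = rscale f a + rscale g a;
  rh_scaleDr : forall f a b, H f -> rscale f (a + b) = rscale f a + rscale f b;
  rh_ipD : forall f g h, H f -> H g -> H h -> ip f (g + h) = ip f g + ip f h;
  rh_ipZ : forall f g a, H f -> H g -> ip f (rscale g a) = ip f g * a;
  rh_ip_conj : forall f g, H f -> H g -> ip g f = qconj (ip f g);
  rh_ip_ge0 : forall f, H f -> 0 <= qc0 (ip f f);
  rh_ip_eq0 : forall f, H f -> ip f f = 0 -> f = 0;
  rh_complete : forall u : nat -> V, (forall n, H (u n)) ->
    (forall e : R, 0 < e -> exists N, forall m n, (N <= m)%N -> (N <= n)%N ->
       ip_norm ip (u m - u n) < e) ->
    exists2 l, H l & ip_norm ip (u n - l) @[n --> \oo] --> (0 : R)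
}.

Definition orthonormal_basis (rscale : V -> quat R -> V)
    (ip : V -> V -> quat R) (H : set V) (psi : nat -> V) : Prop :=
  [/\ forall n, H (psi n),
      forall m n, ip (psi m) (psi n) = (m == n)%:R
    & forall f, H f ->
        ip_norm ip (f - \sum_(0 <= k < n) rscale (psi k) (ip (psi k) f))
          @[n --> \oo] --> (0 : R)].

End RightHilbert.

(* K q p stands for K(q, p), so that K(., p) is K^~ p. *)
Definition reproducing_kernel (R : realType) (T : Type)
    (ip : (T -> quat R) -> (T -> quat R) -> quat R) (H : set (T -> quat R))
    (K : T -> T -> quat R) : Prop :=
  (forall p, H (K^~ p)) /\ (forall f p, H f -> ip (K^~ p) f = f p).

Section Fock.
Variable R : realType.
Implicit Types (q p : quat R) (f g : quat R -> quat R) (alpha : nat -> quat R).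

Definition appell_coef (k j : nat) : R :=
  (2 * (k - j + 1))%:R / ((k + 1) * (k + 2))%:R.

Definition appellQ (k : nat) q : quat R :=
  \sum_(j < k.+1) appell_coef k j *: (q ^+ (k - j) * qconj q ^+ j).

Definition fock_coeffs : set (nat -> quat R) :=
  [set alpha | cvgn (series (fun k => k`!%:R * qabs (alpha k) ^+ 2))].

Definition fock_series alpha q : nat -> quat R :=
  series (fun k => appellQ k q * alpha k).

(* limn is total: the theorem asserts the convergence of these series for
   alpha in fock_coeffs. *)
Definition fock_fun alpha : quat R -> quat R :=
  fun q => limn (fock_series alpha q).

Definition fock : set (quat R -> quat R) := fock_fun @` fock_coeffs.

(* Some sequence of coefficients of f; the theorem asserts its uniqueness. *)
Definition fock_coef f : nat -> quat R :=
  xget (fun=> 0) [set alpha | fock_coeffs alpha /\ fock_fun alpha = f].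

Definition fock_ip_series alpha beta : nat -> quat R :=
  series (fun k => k`!%:R *: (qconj (alpha k) * beta k)).

Definition fock_ip f g : quat R :=
  limn (fock_ip_series (fock_coef f) (fock_coef g)).

Definition fun_rscale f (a : quat R) : quat R -> quat R := fun q => f q * a.

Definition fock_kernel_series q p : nat -> quat R :=
  series (fun k => (k`!%:R)^-1 *: (appellQ k q * qconj (appellQ k p))).

Definition fock_kernel q p : quat R := limn (fock_kernel_series q p).

Definition fock_psi (k : nat) : quat R -> quat R :=
  fun q => (Num.sqrt k`!%:R)^-1 *: appellQ k q.

End Fock.

(* Main.v *)
Require Import Defs.
From HB Require Import structures.
From mathcomp Require Import all_boot all_order all_algebra.
From mathcomp Require Import all_classical all_reals all_analysis.
From mathcomp Require Import ring lra zify.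
Import Order.TTheory GRing.Theory Num.Theory.
Import numFieldNormedType.Exports.
Set Implicit Arguments.
Unset Strict Implicit.
Unset Printing Implicit Defensive.
Local Open Scope classical_set_scope.
Local Open Scope ring_scope.

(** Each Q_k is Fueter regular and grows at most exponentially in k on a ball,
while the coefficients of an element of the Fock space satisfy
sum k! |alpha_k|^2 < oo; everything follows from these two facts.

Regularity of Q_k.  Write W_k = (k+1)(k+2)/2 Q_k and
P_k = sum_(j <= k) q^(k-j) qbar^j.  Then W_(k+1) = qbar W_k + (k+2) q^(k+1)
and W_(k+1) = q W_k + P_(k+1).  Commuting the units past q gives, for g real
homogeneous of degree m and with d0 the derivative along the real axis,
  D(q g) = - 2 (m+1) g + qbar D g + 2 q d0 g,
  D(qbar g) = (4 + 2 m) g + q D g - 2 q d0 g,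
whence D(q^(k+1)) = - 2 P_k (fueter_dpow), and then D W_k = 0 by induction
(fueter_dappellW), using d0 W_(k+1) = (k+3) W_k.

Growth.  The predicate taylor_bounded r M f df bounds by M, on the ball of
radius r, the function f, its differential df, its increments and its
second-order Taylor remainder.  It is stable under sums and products up to a
constant factor, so it holds for Q_k with M = 2 (12 r)^k
(taylor_bounded_appellQ).  Since M |alpha_k| <= M^2/k! + k! |alpha_k|^2 and
sum c^k/k! converges, sum_k Q_k alpha_k inherits a bound of this kind for the
sum of the differentials (taylor_bounded_fock).  A Taylor bound with a linear
df implies differentiability, so sums are differentiated termwise and remain
regular (fock_regular).

Hilbert space.  On the real axis Q_k(x) = x^k, so a sum determines its
coefficients (fock_fun_inj), and the space is isometric to a weighted l^2 space
of quaternionic sequences, whose completeness is proved coefficientwise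
(fock_complete).  The coefficients of K(., p) are conj(Q_k(p))/k!, so pairing
with K(., p) evaluates the series at p; a reproducing kernel is unique because
the scalar product is definite.  The functions psi_k correspond to normalized
sequences supported at one index, and the squared error of the n-th partial
expansion is the n-th tail of sum k! |alpha_k|^2. *)

(** * Quaternionic algebra and norms *)

Section Coordinates.
Variable R : realType.
Implicit Types p q : quat R.

Lemma quat_coord0 : (qc0 (0 : quat R) = 0) * (qc1 (0 : quat R) = 0) *
  (qc2 (0 : quat R) = 0) * (qc3 (0 : quat R) = 0).
Proof. by do !split; exact: mxE. Qed.

Lemma quat_coordN p :
  (qc0 (- p) = - qc0 p) * (qc1 (- p) = - qc1 p) *
  (qc2 (- p) = - qc2 p) * (qc3 (- p) = - qc3 p).
Proof. by do !split; exact: mxE. Qed.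

Lemma quat_coord_ext q : (q : 'rV[R]_4) = quat_of (qc0 q) (qc1 q) (qc2 q) (qc3 q).
Proof. by apply: quat_eqP; rewrite !quat_ofE. Qed.

Lemma quat_coordM p q :
  (qc0 (p * q) = qc0 p * qc0 q - qc1 p * qc1 q - qc2 p * qc2 q - qc3 p * qc3 q) *
  (qc1 (p * q) = qc0 p * qc1 q + qc1 p * qc0 q + qc2 p * qc3 q - qc3 p * qc2 q) *
  (qc2 (p * q) = qc0 p * qc2 q - qc1 p * qc3 q + qc2 p * qc0 q + qc3 p * qc1 q) *
  (qc3 (p * q) = qc0 p * qc3 q + qc1 p * qc2 q - qc2 p * qc1 q + qc3 p * qc0 q).
Proof. by do !split; rewrite [p * q]/(qmul p q) quat_ofE. Qed.

Lemma quat_coord1 : (qc0 (1 : quat R) = 1) * (qc1 (1 : quat R) = 0) *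
  (qc2 (1 : quat R) = 0) * (qc3 (1 : quat R) = 0).
Proof. by rewrite -[1]/(qone R) !quat_ofE. Qed.

Definition quat_coordE :=
  (quat_coord0, quat_coord1, quat_coordD, quat_coordN, quat_coordM, quat_coordZ,
   quat_ofE).

(** The locking keeps unification from unfolding a product or a sum of
quaternions to a term headed by [quat_of] when rewriting. *)
Definition quat_mk (a b c d : R) : quat R := locked (quat_of a b c d).

Lemma quat_mk_coord q : q = quat_mk (qc0 q) (qc1 q) (qc2 q) (qc3 q).
Proof. by rewrite /quat_mk -lock -quat_coord_ext. Qed.

Lemma quat_mk_ind (P : quat R -> Prop) :
  (forall a b c d, P (quat_mk a b c d)) -> forall q, P q.
Proof. by move=> h q; rewrite (quat_mk_coord q). Qed.

Lemma quat_mk_congr (a b c d a' b' c' d' : R) : a = a' -> b = b' -> c = c' ->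
  d = d' -> quat_mk a b c d = quat_mk a' b' c' d'.
Proof. by move=> -> -> -> ->. Qed.

Lemma quat_mkD (a b c d a' b' c' d' : R) :
  quat_mk a b c d + quat_mk a' b' c' d' =
  quat_mk (a + a') (b + b') (c + c') (d + d').
Proof. by rewrite /quat_mk -!lock; apply: quat_eqP; rewrite !quat_coordE; split. Qed.

Lemma quat_mkN (a b c d : R) :
  - quat_mk a b c d = quat_mk (- a) (- b) (- c) (- d).
Proof. by rewrite /quat_mk -!lock; apply: quat_eqP; rewrite !quat_coordE; split. Qed.

Lemma quat_mkZ (x a b c d : R) :
  x *: quat_mk a b c d = quat_mk (x * a) (x * b) (x * c) (x * d).
Proof. by rewrite /quat_mk -!lock; apply: quat_eqP; rewrite !quat_coordE; split. Qed.

Lemma quat_mkM (a b c d a' b' c' d' : R) :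
  quat_mk a b c d * quat_mk a' b' c' d' =
  quat_mk (a * a' - b * b' - c * c' - d * d') (a * b' + b * a' + c * d' - d * c')
    (a * c' - b * d' + c * a' + d * b') (a * d' + b * c' - c * b' + d * a').
Proof. by rewrite /quat_mk -!lock; apply: quat_eqP; rewrite !quat_coordE; split. Qed.

Lemma quat_mk_conj (a b c d : R) :
  qconj (quat_mk a b c d) = quat_mk a (- b) (- c) (- d).
Proof. by rewrite /quat_mk -!lock; apply: quat_eqP; rewrite !quat_coordE; split. Qed.

Lemma quat_mk0 : 0 = quat_mk 0 0 0 0 :> quat R.
Proof. by rewrite /quat_mk -!lock; apply: quat_eqP; rewrite !quat_coordE; split. Qed.

Lemma quat_mk1 : 1 = quat_mk 1 0 0 0 :> quat R.
Proof. by rewrite /quat_mk -lock. Qed.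

Lemma quat_mkE (a b c d : R) :
  (qc0 (quat_mk a b c d) = a) * (qc1 (quat_mk a b c d) = b) *
  (qc2 (quat_mk a b c d) = c) * (qc3 (quat_mk a b c d) = d).
Proof. by rewrite /quat_mk -lock; do !split; rewrite quat_ofE. Qed.

Lemma quat_mk_i : qi R = quat_mk 0 1 0 0.
Proof. by rewrite /quat_mk -lock. Qed.

Lemma quat_mk_j : qj R = quat_mk 0 0 1 0.
Proof. by rewrite /quat_mk -lock. Qed.

Lemma quat_mk_k : qk R = quat_mk 0 0 0 1.
Proof. by rewrite /quat_mk -lock. Qed.

Lemma norm_coord_le q : [/\ `|qc0 q| <= `|q|, `|qc1 q| <= `|q|,
  `|qc2 q| <= `|q| & `|qc3 q| <= `|q|].
Proof.
suff h (i : 'I_4) : `|(q : 'rV[R]_4) 0 i| <= `|q| by split; exact: h.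
rewrite [leRHS]mx_normrE; exact: (le_bigmax _ (fun ij => `|q ij.1 ij.2|) (0, i)).
Qed.

Lemma norm_le_coord q (M : R) : `|qc0 q| <= M -> `|qc1 q| <= M ->
  `|qc2 q| <= M -> `|qc3 q| <= M -> `|q| <= M.
Proof.
move=> h0 h1 h2 h3; rewrite [leLHS]mx_normrE.
apply/bigmax_leP; split; first by exact: le_trans h0.
case=> i j _ /=; rewrite (ord1 i) (quat_coord_ext q) mxE.
by case: j => -[|[|[|[|//]]]].
Qed.

(** The sup norm is submultiplicative only up to a factor, here 4, since each
coordinate of a product is a sum of four products of coordinates. *)
Lemma norm_quatM p q : `|p * q| <= 4 * `|p| * `|q|.
Proof.
have [p0 p1 p2 p3] := norm_coord_le p.
have [q0 q1 q2 q3] := norm_coord_le q.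
have b (x y : R) : `|x| <= `|p| -> `|y| <= `|q| -> `|x * y| <= `|p| * `|q|.
  by move=> hx hy; rewrite normrM ler_pM.
have t (x y z w : R) (M := `|p| * `|q|) :
    `|x| <= M -> `|y| <= M -> `|z| <= M -> `|w| <= M ->
    `|x + y + z + w| <= 4 * `|p| * `|q|.
  by rewrite -mulrA -/M !ler_norml => *; lra.
by apply: norm_le_coord; rewrite quat_coordM; apply: t; rewrite ?normrN; exact: b.
Qed.

Lemma norm_qconj q : `|qconj q| <= `|q|.
Proof.
by have [? ? ? ?] := norm_coord_le q; apply: norm_le_coord; rewrite quat_ofE ?normrN.
Qed.

Lemma qconjD p q : qconj (p + q) = qconj p + qconj q.
Proof. by apply: quat_eqP; rewrite !quat_coordE; split; ring. Qed.

Lemma qconjZ (a : R) q : qconj (a *: q) = a *: qconj q.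
Proof. by apply: quat_eqP; rewrite !quat_coordE; split; ring. Qed.

Lemma qconjM p q : qconj (p * q) = qconj q * qconj p.
Proof. by apply: quat_eqP; rewrite !quat_coordE; split; ring. Qed.

Lemma qconjK q : qconj (qconj q) = q.
Proof. by apply: quat_eqP; rewrite !quat_coordE; split; ring. Qed.

Lemma qconj0 : qconj (0 : quat R) = 0.
Proof. by apply: quat_eqP; rewrite !quat_coordE; split; ring. Qed.

Lemma qconj_comm q : q * qconj q = qconj q * q.
Proof. by apply: quat_eqP; rewrite !quat_coordE; split; ring. Qed.

Lemma qabs2E q : qabs q ^+ 2 = qc0 q ^+ 2 + qc1 q ^+ 2 + qc2 q ^+ 2 + qc3 q ^+ 2.
Proof. by rewrite sqr_sqrtr // !addr_ge0 ?sqr_ge0. Qed.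

Lemma qabs2_conj q : qc0 (qconj q * q) = qabs q ^+ 2.
Proof. by rewrite qabs2E !quat_coordE; ring. Qed.

Lemma norm_le_qabs q : `|q| ^+ 2 <= qabs q ^+ 2.
Proof.
suff : `|q| <= qabs q by move=> h; rewrite ler_sqr ?nnegrE ?sqrtr_ge0.
have h (x y z w : R) : `|x| <= Num.sqrt (x ^+ 2 + y ^+ 2 + z ^+ 2 + w ^+ 2).
  by rewrite -sqrtr_sqr ler_wsqrtr // -!addrA lerDl !addr_ge0 ?sqr_ge0.
by apply: norm_le_coord; rewrite /qabs;
  [exact: h|rewrite [_ ^+ 2 + qc1 q ^+ 2]addrC; exact: h
  |rewrite [_ + qc2 q ^+ 2]addrC addrA; exact: h
  |rewrite [_ + qc3 q ^+ 2]addrC !addrA; exact: h].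
Qed.

Lemma qabs2_le_norm q : qabs q ^+ 2 <= 4 * `|q| ^+ 2.
Proof.
have [q0 q1 q2 q3] := norm_coord_le q.
have h (x : R) : `|x| <= `|q| -> x ^+ 2 <= `|q| ^+ 2.
  by move=> hx; rewrite -real_normK ?num_real // ler_sqr ?nnegrE.
by have := (h _ q0, h _ q1, h _ q2, h _ q3) => -[[[? ?] ?] ?]; rewrite qabs2E; lra.
Qed.

Lemma qabs2D p q : qabs (p + q) ^+ 2 <= 2 * qabs p ^+ 2 + 2 * qabs q ^+ 2.
Proof.
rewrite !qabs2E !quat_coordE.
have h (x y : R) : (x + y) ^+ 2 <= 2 * x ^+ 2 + 2 * y ^+ 2.
  by have := sqr_ge0 (x - y); lra.
by have := (h (qc0 p) (qc0 q), h (qc1 p) (qc1 q), h (qc2 p) (qc2 q),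
  h (qc3 p) (qc3 q)) => -[[[? ?] ?] ?]; lra.
Qed.

Lemma qabsM2 p q : qabs (p * q) ^+ 2 = qabs p ^+ 2 * qabs q ^+ 2.
Proof. by rewrite !qabs2E !quat_coordE; ring. Qed.

Lemma qabs_conj2 q : qabs (qconj q) ^+ 2 = qabs q ^+ 2.
Proof. by rewrite !qabs2E !quat_coordE; ring. Qed.

Lemma qabsZ2 (a : R) q : qabs (a *: q) ^+ 2 = a ^+ 2 * qabs q ^+ 2.
Proof. by rewrite !qabs2E !quat_coordE; ring. Qed.

Lemma qabs2_eq0 q : qabs q ^+ 2 = 0 -> q = 0.
Proof.
move=> h; have := norm_le_qabs q; rewrite h => n0.
by apply/eqP; rewrite -normr_eq0 -sqrf_eq0 eq_le n0 sqr_ge0.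
Qed.

End Coordinates.

(** * The Appell polynomials *)

(* Identities between noncommuting quaternions are checked on coordinates:
   every quaternion variable is replaced by generic coordinates, both sides are
   normalized to one [quat_mk], and the four real identities are left to
   [ring]. *)
Ltac quat_ring :=
  repeat match goal with H : ?P |- _ =>
    match type of P with Prop => clear H end end;
  repeat match goal with q : _ |- _ =>
    revert q; refine (quat_mk_ind _); intros ? ? ? ? end;
  rewrite ?quat_mk_i ?quat_mk_j ?quat_mk_k ?quat_mk0 ?quat_mk1;
  rewrite ?(quat_mkE, quat_mkM, quat_mkD, quat_mkN, quat_mkZ, quat_mk_conj);
  apply: quat_mk_congr; ring.

Section Polynomials.
Variable R : realType.
Implicit Types (p q v : quat R).

(** The sum of the q^(k-j) qbar^j over j <= k. *)
Fixpoint powsum (k : nat) q : quat R :=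
  if k is l.+1 then qconj q * powsum l q + q ^+ k else 1.

(** The polynomial (k+1)(k+2)/2 Q_k, by a recursion that suits both the
computation of the Fueter operator and the Taylor bounds. *)
Fixpoint appellW (k : nat) q : quat R :=
  if k is l.+1 then qconj q * appellW l q + k.+1%:R *: q ^+ k else 1.

Lemma appellW_rec k q :
  appellW k.+1 q = qconj q * appellW k q + k.+2%:R *: q ^+ k.+1.
Proof. by []. Qed.

Lemma powsum_rec k q : powsum k.+1 q = qconj q * powsum k q + q ^+ k.+1.
Proof. by []. Qed.

Lemma appellW_sum k q :
  appellW k q = \sum_(j < k.+1) (k - j + 1)%:R *: (q ^+ (k - j) * qconj q ^+ j).
Proof.
elim: k => [|k IH]; first by rewrite big_ord1 !expr0 mulr1 scale1r.
rewrite big_ord_recl subn0 addn1 expr0 mulr1 appellW_rec addrC IH; congr (_ + _).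
rewrite mulr_sumr; apply: eq_bigr => j _.
rewrite lift0 subSS -scalerAr; congr (_ *: _).
have c n : qconj q * q ^+ n = q ^+ n * qconj q.
  by apply: commrX; rewrite /GRing.comm qconj_comm.
by rewrite mulrA c -mulrA exprS.
Qed.

Lemma appellQE k q :
  appellQ k q = (2 / ((k + 1) * (k + 2))%:R) *: appellW k q.
Proof.
rewrite appellW_sum scaler_sumr; apply: eq_bigr => j _.
by rewrite scalerA /appell_coef natrM mulrAC.
Qed.

(** A second recursion, multiplying by q instead of qbar: it is what cancels
the terms left over in the induction of [fueter_dappellW]. *)
Lemma appellWS k q : appellW k.+1 q = q * appellW k q + powsum k.+1 q.
Proof.
elim: k => [|k IH]; first by rewrite /= !mulr1 expr1; quat_ring.
rewrite appellW_rec {1}IH appellW_rec !powsum_rec [q ^+ k.+2]exprS.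
move: (appellW k q) (powsum k q) (q ^+ k.+1) => w s x.
quat_ring.
Qed.

Lemma appellW_real k (x : R) :
  appellW k x%:A = (((k + 1) * (k + 2))%:R / 2 * x ^+ k)%:A.
Proof.
have e (n : nat) : (x%:A : quat R) ^+ n = (x ^+ n)%:A.
  by elim: n => [|n IH]; rewrite ?expr0 ?scale1r // !exprS IH -scalerAl mul1r scalerA.
elim: k => [|k IH]; first by rewrite expr0 mulr1 mul1n divff // scale1r.
rewrite appellW_rec IH e qconjZ [qconj 1](_ : _ = 1); last quat_ring.
rewrite -scalerAl mul1r !scalerA -scalerDl exprS !natrM !natrD; congr (_ *: _).
by rewrite -!natr1; field.
Qed.

(** The coefficients T^k_j add up to 1. *)
Lemma appellQ_real k (x : R) : appellQ k x%:A = (x ^+ k)%:A.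
Proof.
rewrite appellQE appellW_real scalerA; congr (_ *: _).
by rewrite mulrA mulrA divfK ?pnatr_eq0 ?addn1 ?addn2 // divff ?mul1r ?pnatr_eq0.
Qed.

(** * Formal differentials and the Fueter operator *)

(** The differentials at q, in the direction v, of q^k and of [appellW k], as
given by the product rule.  They are identified with analytic differentials by
[taylor_bounded_diff]. *)
Fixpoint dpow (k : nat) q v : quat R :=
  if k is l.+1 then v * q ^+ l + q * dpow l q v else 0.

Fixpoint dappellW (k : nat) q v : quat R :=
  if k is l.+1 then
    qconj v * appellW l q + qconj q * dappellW l q v + k.+1%:R *: dpow k q v
  else 0.

Lemma dpow_rec k q v : dpow k.+1 q v = v * q ^+ k + q * dpow k q v.
Proof. by []. Qed.

Lemma dappellW_rec k q v : dappellW k.+1 q v =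
  qconj v * appellW k q + qconj q * dappellW k q v + k.+2%:R *: dpow k.+1 q v.
Proof. by []. Qed.

Lemma dpow_linear k q : linear (dpow k q).
Proof.
elim: k => [|k IH] a u v; first by rewrite /= scaler0 addr0.
by rewrite !dpow_rec IH; move: (dpow k q u) (dpow k q v) (q ^+ k) => *; quat_ring.
Qed.

Lemma dappellW_linear k q : linear (dappellW k q).
Proof.
elim: k => [|k IH] a u v; first by rewrite /= scaler0 addr0.
rewrite !dappellW_rec IH dpow_linear.
move: (dappellW k q u) (dappellW k q v) (appellW k q) => *.
move: (dpow k.+1 q u) (dpow k.+1 q v) => *; quat_ring.
Qed.

Lemma dpow_euler k q : dpow k q q = k%:R *: q ^+ k.
Proof.
elim: k => [|k IH]; first by rewrite scale0r.
by rewrite dpow_rec IH exprS; move: (q ^+ k) => *; quat_ring.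
Qed.

Lemma dappellW_euler k q : dappellW k q q = k%:R *: appellW k q.
Proof.
elim: k => [|k IH]; first by rewrite scale0r.
rewrite dappellW_rec dpow_euler IH appellW_rec exprS.
move: (q ^+ k) (appellW k q) => *; quat_ring.
Qed.

Lemma dpow_1 k q : dpow k.+1 q 1 = k.+1%:R *: q ^+ k.
Proof.
elim: k => [|k IH]; first by rewrite /= mulr0 addr0 mulr1 scale1r.
rewrite dpow_rec IH exprS; move: (q ^+ k) => *; quat_ring.
Qed.

Lemma dappellW_1 k q : dappellW k.+1 q 1 = k.+3%:R *: appellW k q.
Proof.
elim: k => [|k IH]; first by rewrite /= expr0; quat_ring.
rewrite dappellW_rec IH dpow_1 appellW_rec; move: (q ^+ k.+1) (appellW k q) => *; quat_ring.
Qed.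

(** What the Fueter operator gives on a function with differential L. *)
Definition fueter_symbol (L : quat R -> quat R) : quat R :=
  L 1 + qi R * L (qi R) + qj R * L (qj R) + qk R * L (qk R).

Lemma linear_coord (L : quat R -> quat R) q : linear L ->
  L q = qc0 q *: L 1 + qc1 q *: L (qi R) + qc2 q *: L (qj R) + qc3 q *: L (qk R).
Proof.
move=> linL; have L0 : L 0 = 0.
  by have := linL (-1) 0 0; rewrite scaler0 addr0 scaleN1r addNr.
rewrite {1}(_ : q = qc0 q *: 1 +
  (qc1 q *: qi R + (qc2 q *: qj R + (qc3 q *: qk R + 0)))); last quat_ring.
by rewrite !linL L0 addr0 !addrA.
Qed.

(** The Leibniz rule for the Fueter operator and a left factor q.  The units do
not commute with q: for e = i, j, k one has e q = qbar e - 2 x_e, where x_e is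
the coordinate of q along e, and these corrections add up to the derivatives L q
along q itself and L 1 along the real axis. *)
Lemma fueter_symbol_mull (L : quat R -> quat R) q (g : quat R) : linear L ->
  fueter_symbol (fun v => v * g + q * L v) =
    - 2 *: g + qconj q * fueter_symbol L - 2 *: L q + 2 *: (q * L 1).
Proof.
move=> /linear_coord h; rewrite /fueter_symbol (h q).
move: (L 1) (L (qi R)) (L (qj R)) (L (qk R)) => *; quat_ring.
Qed.

Lemma fueter_symbol_conj_mull (L : quat R -> quat R) q (g : quat R) : linear L ->
  fueter_symbol (fun v => qconj v * g + qconj q * L v) =
    4 *: g + q * fueter_symbol L + 2 *: L q - 2 *: (q * L 1).
Proof.
move=> /linear_coord h; rewrite /fueter_symbol (h q).
move: (L 1) (L (qi R)) (L (qj R)) (L (qk R)) => *; quat_ring.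
Qed.

Lemma fueter_symbolD (L M : quat R -> quat R) (a : R) :
  fueter_symbol (fun v => L v + a *: M v) = fueter_symbol L + a *: fueter_symbol M.
Proof.
rewrite /fueter_symbol.
move: (L 1) (L (qi R)) (L (qj R)) (L (qk R)) (M 1) (M (qi R)) (M (qj R)) (M (qk R)).
move=> *; quat_ring.
Qed.

(** Here L q and L 1 in [fueter_symbol_mull] are multiples of q^(k+1) and q^k,
and the recursion of [powsum] appears. *)
Lemma fueter_dpow k q : fueter_symbol (dpow k.+1 q) = - 2 *: powsum k q.
Proof.
elim: k => [|k IH].
  by rewrite /fueter_symbol /= expr0; quat_ring.
rewrite [LHS](fueter_symbol_mull _ _ (@dpow_linear k.+1 q)) IH dpow_euler dpow_1.
rewrite powsum_rec exprS; move: (q ^+ k) (powsum k q) => *; quat_ring.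
Qed.

(** With W = [appellW] and P = [powsum], the induction step leaves
2(k+2) (W_k - q W_(k-1) - P_k), which vanishes by [appellWS]. *)
Lemma fueter_dappellW k q : fueter_symbol (dappellW k q) = 0.
Proof.
elim: k => [|k IH]; first by rewrite /fueter_symbol /= !mulr0 !addr0.
rewrite [LHS]fueter_symbolD (fueter_symbol_conj_mull _ _ (@dappellW_linear k q)).
rewrite IH fueter_dpow dappellW_euler.
case: k {IH} => [|k]; first by rewrite /=; quat_ring.
rewrite dappellW_1 appellWS; move: (appellW k q) (powsum k.+1 q) => *; quat_ring.
Qed.

(** * Taylor bounds *)

(** Keeping the four estimates under one constant makes the predicate stable
under products, sums and dominated series. *)
Definition taylor_bounded (r M : R) (f : quat R -> quat R)
    (df : quat R -> quat R -> quat R) : Prop :=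
  forall q v, `|q| <= r -> `|q + v| <= r ->
  [/\ `|f q| <= M, `|df q v| <= M * `|v|, `|f (q + v) - f q| <= M * `|v|
    & `|f (q + v) - f q - df q v| <= M * `|v| ^+ 2].

Lemma taylor_bounded_le (r M N : R) f df : M <= N ->
  taylor_bounded r M f df -> taylor_bounded r N f df.
Proof.
move=> MN h q v hq hv; have [h1 h2 h3 h4] := h q v hq hv.
split; [exact: le_trans h1 _|apply: le_trans h2 _|apply: le_trans h3 _|
  apply: le_trans h4 _]; by rewrite ?ler_wpM2r ?exprn_ge0.
Qed.

Lemma taylor_bounded_cst (r M : R) c : `|c| <= M ->
  taylor_bounded r M (fun=> c) (fun _ _ => 0).
Proof.
move=> cM q v _ _; have M0 : 0 <= M by exact: le_trans cM.
by rewrite !subrr normr0; split => //; rewrite mulr_ge0 ?exprn_ge0.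
Qed.

Lemma taylor_bounded_id (r : R) : 1 <= r ->
  taylor_bounded r r (fun q => q) (fun _ v => v).
Proof.
move=> r1 q v qr _; have r0 : 0 <= r by exact: le_trans r1.
rewrite [q + v]addrC addrK subrr normr0; split; rewrite ?ler_peMl //.
by rewrite mulr_ge0 ?exprn_ge0.
Qed.

Lemma taylor_bounded_qconj (r : R) : 1 <= r ->
  taylor_bounded r r (@qconj R) (fun _ v => qconj v).
Proof.
move=> r1 q v qr _; have r0 : 0 <= r by exact: le_trans r1.
rewrite qconjD [qconj q + _]addrC addrK subrr normr0.
split; rewrite ?(le_trans (norm_qconj _)) ?ler_peMl //.
by rewrite mulr_ge0 ?exprn_ge0.
Qed.

Lemma taylor_boundedD (r M N : R) f df g dg :
  taylor_bounded r M f df -> taylor_bounded r N g dg ->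
  taylor_bounded r (M + N) (fun q => f q + g q) (fun q v => df q v + dg q v).
Proof.
move=> hf hg q v hq hv; have [f1 f2 f3 f4] := hf q v hq hv.
have [g1 g2 g3 g4] := hg q v hq hv.
have t (a b : quat R) (A B : R) : `|a| <= A -> `|b| <= B -> `|a + b| <= A + B.
  by move=> ha hb; apply: le_trans (ler_normD _ _) _; exact: lerD.
have e (a b c d : quat R) : a + b - (c + d) = (a - c) + (b - d).
  by rewrite opprD addrACA.
by split; rewrite ?mulrDl; [|
  |rewrite e|rewrite [X in X - _]e e]; apply: t.
Qed.

Lemma taylor_boundedZ (r M a : R) f df :
  taylor_bounded r M f df ->
  taylor_bounded r (`|a| * M) (fun q => a *: f q) (fun q v => a *: df q v).
Proof.
move=> hf q v hq hv; have [f1 f2 f3 f4] := hf q v hq hv.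
by rewrite -!scalerBr !normrZ -!mulrA; split; rewrite ler_wpM2l.
Qed.

(** The remainder of a product has three terms, each at most 4 M N |v|^2, where
4 is the constant of [norm_quatM]. *)
Lemma taylor_boundedM (r M N : R) f df g dg :
  taylor_bounded r M f df -> taylor_bounded r N g dg ->
  taylor_bounded r (12 * M * N) (fun q => f q * g q)
    (fun q v => df q v * g q + f q * dg q v).
Proof.
move=> hf hg q v hq hv; have [f1 f2 f3 f4] := hf q v hq hv.
have [g1 g2 g3 g4] := hg q v hq hv.
have qv' : `|q + v + 0| <= r by rewrite addr0.
have [g5 _ _ _] := hg _ _ hv qv'.
have M0 : 0 <= M by exact: le_trans f1.
have N0 : 0 <= N by exact: le_trans g1.
have b (x y : quat R) (A B : R) : `|x| <= A -> `|y| <= B -> `|x * y| <= 4 * A * B.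
  move=> hx hy; apply: le_trans (norm_quatM _ _) _; rewrite -!mulrA ler_wpM2l //.
  exact: ler_pM.
have pos : 0 <= M * N * `|v| by rewrite !mulr_ge0.
have pos2 : 0 <= M * N by rewrite !mulr_ge0.
have vv : `|v| ^+ 2 = `|v| * `|v| by rewrite expr2.
split.
- by apply: le_trans (b _ _ _ _ f1 g1) _; lra.
- apply: le_trans (ler_normD _ _) _.
  by have := lerD (b _ _ _ _ f2 g1) (b _ _ _ _ f1 g2); lra.
- have -> : f (q + v) * g (q + v) - f q * g q =
      (f (q + v) - f q) * g (q + v) + f q * (g (q + v) - g q).
    by rewrite mulrBl mulrBr addrA subrK.
  apply: le_trans (ler_normD _ _) _.
  by have := lerD (b _ _ _ _ f3 g5) (b _ _ _ _ f1 g3); lra.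
- have -> : f (q + v) * g (q + v) - f q * g q - (df q v * g q + f q * dg q v) =
      (f (q + v) - f q - df q v) * g (q + v) + f q * (g (q + v) - g q - dg q v)
      + df q v * (g (q + v) - g q).
    move: (f _) (f q) (g _) (g q) (df q v) (dg q v) => *; quat_ring.
  apply: le_trans (ler_normD _ _) _.
  apply: le_trans (lerD (ler_normD _ _) (lexx _)) _.
  have := lerD (lerD (b _ _ _ _ f4 g5) (b _ _ _ _ f1 g4)) (b _ _ _ _ f2 g3).
  by move/le_trans; apply; rewrite vv le_eqVlt; apply/orP; left; apply/eqP; ring.
Qed.

Lemma taylor_bounded_pow k (r : R) : 1 <= r ->
  taylor_bounded r ((12 * r) ^+ k) (fun q => q ^+ k) (dpow k).
Proof.
move=> r1; elim: k => [|k IH].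
  apply: (@taylor_bounded_cst r); apply: norm_le_coord;
  by rewrite quat_coord1 ?normr1 ?normr0.
rewrite exprS; under eq_fun do rewrite exprS.
exact: taylor_boundedM (taylor_bounded_id r1) IH.
Qed.

(** The constants satisfy (k+1)^2 + (k+2) <= (k+2)^2, which closes the
recursion. *)
Lemma taylor_bounded_appellW k (r : R) : 1 <= r ->
  taylor_bounded r ((k.+1 ^ 2)%:R * (12 * r) ^+ k) (appellW k) (dappellW k).
Proof.
move=> r1; elim: k => [|k IH].
  rewrite mul1r; exact: (taylor_bounded_pow 0 r1).
have := taylor_boundedD (taylor_boundedM (taylor_bounded_qconj r1) IH)
  (taylor_boundedZ (k.+2%:R) (taylor_bounded_pow k.+1 r1)).
apply: taylor_bounded_le; rewrite ger0_norm // mulrCA -exprS -mulrDl.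
rewrite ler_wpM2r ?exprn_ge0 ?mulr_ge0 ?(le_trans _ r1) //.
rewrite -natrD ler_nat; nia.
Qed.

Definition dappellQ k q v := (2 / ((k + 1) * (k + 2))%:R : R) *: dappellW k q v.

Lemma dappellQ_linear k q : linear (dappellQ k q).
Proof.
move=> a u v; rewrite /dappellQ dappellW_linear scalerDr !scalerA.
by rewrite [_ * a]mulrC.
Qed.

Lemma taylor_bounded_appellQ k (r : R) : 1 <= r ->
  taylor_bounded r (2 * (12 * r) ^+ k) (@appellQ R k) (dappellQ k).
Proof.
move=> r1; rewrite (funext (appellQE k)).
apply: taylor_bounded_le (taylor_boundedZ _ (taylor_bounded_appellW k r1)).
rewrite mulrA ler_wpM2r ?exprn_ge0 ?mulr_ge0 ?(le_trans _ r1) //.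
rewrite ger0_norm ?divr_ge0 // mulrAC ler_pdivrMr ?ltr0n; last nia.
by rewrite -!natrM ler_nat; nia.
Qed.

Lemma fueter_dappellQ k q : fueter_symbol (dappellQ k q) = 0.
Proof.
by have := fueter_symbolD (fun=> 0) (dappellW k q) (2 / ((k + 1) * (k + 2))%:R);
  rewrite fueter_dappellW /fueter_symbol /dappellQ !add0r !mulr0 scaler0 !addr0.
Qed.

End Polynomials.

(** * Differentiability from Taylor bounds *)

Section Differentiability.
Variable R : realType.

(** The estimate of the differential makes it continuous, and the quadratic
remainder is negligible with respect to the increment. *)
Lemma taylor_bounded_diff (f : quat R -> quat R) df (q : quat R) (r M : R) :
  `|q| < r -> taylor_bounded r M f df -> linear (df q) ->
  differentiable f q /\ ('d f q = df q :> (quat R -> quat R)).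
Proof.
move=> qr hf lin_df.
pose L : {linear quat R -> quat R} :=
  HB.pack (df q) (GRing.isLinear.Build R (quat R) (quat R) *:%R (df q) lin_df).
have near_r : \forall v \near (0 : quat R), `|q + v| <= r.
  near=> v; apply: le_trans (ler_normD _ _) _; rewrite -lerBrDl.
  near: v; apply: (@nbhs0_le _ (quat R)); by rewrite subr_gt0.
have M0 : 0 <= M.
  have [] := hf q 0; rewrite ?addr0 ?(ltW qr) // => h *; exact: le_trans h.
have Lc : continuous L.
  apply/linear_bounded_continuous; apply/ex_bound; exists (M * 1); near=> v.
  have qvr : `|q + v| <= r by near: v; exact: near_r.
  have [_ h _ _] := hf q v (ltW qr) qvr.
  apply: le_trans h _; rewrite ler_wpM2l //; near: v; exact: (@nbhs0_le _ (quat R)).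
have dfE : f \o shift q = cst (f q) + L +o_ 0 id.
  apply/eqaddoP => e e0; near=> v.
  have qvr : `|q + v| <= r by near: v; exact: near_r.
  have [_ _ _ h] := hf q v (ltW qr) qvr.
  rewrite /= !fctE opprD addrA [v + q]addrC.
  apply: le_trans h _; rewrite expr2 mulrA ler_wpM2r //.
  apply: (@le_trans _ _ ((M + 1) * `|v|)); first by rewrite ler_wpM2r // lerDl.
  rewrite -ler_pdivlMl ?ltr_wpDl // mulrC.
  near: v; apply: (@nbhs0_le _ (quat R)); by rewrite divr_gt0 ?ltr_wpDl.
have dE : 'd f q = L :> (quat R -> quat R) by exact: diff_unique.
by split => //; apply/diff_locallyP; rewrite dE.
Unshelve. all: by end_near. Qed.

Lemma taylor_bounded_fueter (f : quat R -> quat R) df :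
  (forall r, 1 <= r -> exists M, taylor_bounded r M f df) ->
  (forall q, linear (df q)) -> (forall q, fueter_symbol (df q) = 0) ->
  fueter_regular f.
Proof.
move=> hf lin_df fueter_df q.
have [|M hM] := hf (`|q| + 1); first by rewrite lerDr.
have [|fd dE] := taylor_bounded_diff _ hM (lin_df q); first by rewrite ltrDl.
by split=> //; rewrite -(fueter_df q) /fueter_op !deriveE // dE.
Qed.

End Differentiability.

(** * Series in normed spaces *)

Section Series.
Variable R : realType.

Lemma series_dominated (V : completeNormedModType R) (u : nat -> V) (b : nat -> R) :
  (forall k, `|u k| <= b k) -> cvgn (series b) ->
  cvgn (series u) /\ `|limn (series u)| <= limn (series b).
Proof.
move=> ub cb; have cn : cvgn [normed series u].
  by apply: series_le_cvg cb => [k|k|k]; rewrite ?normr_ge0 ?ub ?(le_trans _ (ub k)).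
split; first exact: normed_cvg.
exact: le_trans (lim_series_norm cn) (lim_series_le cn cb ub).
Qed.

(** Multiplications on either side, the conjugation and the real coordinates are
all instances of G. *)
Lemma additive_cvg (V W : normedModType R) (G : V -> W) (C : R) (u : nat -> V) l :
  {morph G : x y / x + y} -> (forall x, `|G x| <= C * `|x|) ->
  u @ \oo --> l -> (G \o u) @ \oo --> G l.
Proof.
move=> GD GC ul; have G0 : G 0 = 0 by apply: (addrI (G 0)); rewrite -GD !addr0.
have GB x y : G (x - y) = G x - G y.
  by apply/eqP; rewrite eq_sym subr_eq -GD subrK.
have C1 : 0 < `|C| + 1 by rewrite ltr_wpDl.
apply/cvgrPdist_le => e e0; near=> n; rewrite /= -GB.
apply: le_trans (GC _) _; apply: (@le_trans _ _ ((`|C| + 1) * `|l - u n|)).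
  by rewrite ler_wpM2r // (le_trans (ler_norm _)) // lerDl.
rewrite -ler_pdivlMl // mulrC; near: n.
by move/cvgrPdist_le : ul; apply; rewrite divr_gt0.
Unshelve. all: by end_near. Qed.

Lemma additive_series (V W : normedModType R) (G : V -> W) (C : R) (u : nat -> V) :
  {morph G : x y / x + y} -> (forall x, `|G x| <= C * `|x|) ->
  cvgn (series u) -> series (G \o u) @ \oo --> G (limn (series u)).
Proof.
move=> GD GC cu; have G0 : G 0 = 0 by apply: (addrI (G 0)); rewrite -GD !addr0.
rewrite (_ : series (G \o u) = G \o series u); last first.
  by apply/funext => n; rewrite /series /= (big_morph G GD G0).
exact: (additive_cvg GD GC cu).
Qed.

Lemma cvg_seriesD (V : normedModType R) (u w : nat -> V) :
  cvgn (series u) -> cvgn (series w) ->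
  series (fun k => u k + w k) @ \oo --> limn (series u) + limn (series w).
Proof.
move=> cu cw; rewrite [X in X @ _](_ : _ = series u + series w); first exact: cvgD.
by apply/funext => n; rewrite /series /= big_split.
Qed.

Lemma cvg_seriesZ (V : normedModType R) (a : R) (u : nat -> V) :
  cvgn (series u) -> series (fun k => a *: u k) @ \oo --> a *: limn (series u).
Proof.
move=> cu; rewrite [X in X @ _](_ : _ = a *: series u); first exact: cvgZl_tmp.
by apply/funext => n; rewrite /series /= -scaler_sumr.
Qed.

Lemma cvg_seriesB (V : normedModType R) (u w : nat -> V) :
  cvgn (series u) -> cvgn (series w) ->
  series (fun k => u k - w k) @ \oo --> limn (series u) - limn (series w).
Proof.
move=> cu cw; rewrite [X in X @ _](_ : _ = series u - series w); first exact: cvgB.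
by apply/funext => n; rewrite /series /= sumrB.
Qed.

Lemma series_single (V : normedModType R) n (c : V) :
  series (fun k => if k == n then c else 0) @ \oo --> c.
Proof.
apply: cvg_near_cst; exists n.+1 => // N /= nN.
by rewrite /series /= -big_mkcond /= big_nat1_eq nN.
Qed.

Implicit Types (u : nat -> quat R).

Lemma cvg_series_mulr u a : cvgn (series u) ->
  series (fun k => u k * a) @ \oo --> limn (series u) * a.
Proof.
apply: (@additive_series (quat R) (quat R) (fun x => x * a) (4 * `|a|) u) => [x y|x].
  by rewrite mulrDl.
by apply: le_trans (norm_quatM _ _) _; rewrite mulrAC.
Qed.

Lemma cvg_series_mull u a : cvgn (series u) ->
  series (fun k => a * u k) @ \oo --> a * limn (series u).
Proof.
apply: (@additive_series (quat R) (quat R) (fun x => a * x) (4 * `|a|) u) => [x y|x].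
  by rewrite mulrDr.
exact: norm_quatM.
Qed.

Lemma cvg_series_qconj u : cvgn (series u) ->
  series (fun k => qconj (u k)) @ \oo --> qconj (limn (series u)).
Proof.
apply: (@additive_series (quat R) (quat R) (@qconj R) 1 u) => [x y|x]; first exact: qconjD.
by rewrite mul1r norm_qconj.
Qed.

Lemma cvg_series_qc0 u : cvgn (series u) ->
  series (fun k => qc0 (u k)) @ \oo --> qc0 (limn (series u)).
Proof.
apply: (@additive_series (quat R) R^o (@qc0 R) 1 u) => [x y|x]; first by rewrite quat_coordD.
by have [] := norm_coord_le x; rewrite mul1r.
Qed.

Lemma cvg_qabs2 u (l : quat R) : u @ \oo --> l ->
  (fun n => qabs (u n) ^+ 2) @ \oo --> qabs l ^+ 2.
Proof.
move=> ul; under eq_fun do rewrite qabs2E.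
rewrite qabs2E.
have h (G : quat R -> R) : {morph G : x y / x + y} -> (forall x, `|G x| <= `|x|) ->
    (fun n => G (u n) ^+ 2) @ \oo --> G l ^+ 2.
  move=> GD GC; have Gu : (G \o u) @ \oo --> G l.
    by apply: (@additive_cvg (quat R) R^o G 1 u l GD _ ul) => x; rewrite mul1r; exact: GC.
  rewrite expr2; under eq_fun do rewrite expr2; exact: (cvgM Gu Gu).
by apply: cvgD; [apply: cvgD; [apply: cvgD|]|]; apply: h => x;
  [move=> y; rewrite quat_coordD|by have [] := norm_coord_le x
  |move=> y; rewrite quat_coordD|by have [] := norm_coord_le x
  |move=> y; rewrite quat_coordD|by have [] := norm_coord_le x
  |move=> y; rewrite quat_coordD|by have [] := norm_coord_le x].
Qed.

Lemma series_ge0_le_lim (b : nat -> R) n : (forall k, 0 <= b k) ->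
  cvgn (series b) -> series b n <= limn (series b).
Proof.
move=> b0 cb; apply: nondecreasing_cvgn_le => //.
by apply: nondecreasing_series => k _.
Qed.

Lemma series_ge0_bounded (b : nat -> R) M : (forall k, 0 <= b k) ->
  (forall n, series b n <= M) -> cvgn (series b) /\ limn (series b) <= M.
Proof.
move=> b0 bM; have cb : cvgn (series b).
  apply: nondecreasing_is_cvgn; first by apply: nondecreasing_series => k _.
  by exists M => _ [n _ <-].
by split => //; apply: limr_le => //; exact: nearW.
Qed.

End Series.

(** * Coefficient sequences *)

Section Coefficients.
Variable R : realType.
Implicit Types (alpha beta : nat -> quat R) (q p v : quat R).

Definition energy alpha (k : nat) : R := k`!%:R * qabs (alpha k) ^+ 2.

Definition coef_norm2 alpha : R := limn (series (energy alpha)).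

Definition coef_ip alpha beta : quat R := limn (fock_ip_series alpha beta).

Definition single (n : nat) (c : quat R) : nat -> quat R :=
  fun k => if k == n then c else 0.

Definition kernel_coef p : nat -> quat R :=
  fun k => (k`!%:R)^-1 *: qconj (appellQ k p).

Lemma fact_gt0R k : 0 < k`!%:R :> R.
Proof. by rewrite ltr0n fact_gt0. Qed.

Lemma fact_neq0R k : k`!%:R != 0 :> R.
Proof. by rewrite gt_eqF ?fact_gt0R. Qed.

Lemma energy_ge0 alpha k : 0 <= energy alpha k.
Proof. by rewrite mulr_ge0 ?exprn_ge0 ?sqrtr_ge0. Qed.

Lemma coef_norm2_ge0 alpha : fock_coeffs alpha -> 0 <= coef_norm2 alpha.
Proof.
by move=> /(series_ge0_le_lim 0 (energy_ge0 alpha)); rewrite /series /= big_nil.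
Qed.

Lemma energy_le_coef_norm2 alpha k : fock_coeffs alpha -> energy alpha k <= coef_norm2 alpha.
Proof.
move=> /(series_ge0_le_lim k.+1 (energy_ge0 alpha)); apply: le_trans.
by rewrite /series /= big_nat_recr //= lerDr sumr_ge0 // => i _; exact: energy_ge0.
Qed.

Lemma coef_norm2_eq0 alpha : fock_coeffs alpha -> coef_norm2 alpha = 0 -> alpha = 0.
Proof.
move=> ca h; apply/funext => k; apply: qabs2_eq0; apply/eqP.
have := energy_le_coef_norm2 k ca; rewrite h /energy pmulr_rle0 ?fact_gt0R // => h0.
by rewrite eq_le h0 sqr_ge0.
Qed.

Lemma fock_coeffs_le alpha (b : nat -> R) : (forall k, energy alpha k <= b k) ->
  cvgn (series b) -> fock_coeffs alpha.
Proof.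
move=> ab; apply: series_le_cvg => // k; first exact: energy_ge0.
exact: le_trans (energy_ge0 alpha k) (ab k).
Qed.

Lemma fock_coeffsD alpha beta :
  fock_coeffs alpha -> fock_coeffs beta -> fock_coeffs (alpha + beta).
Proof.
move=> ca cb; apply: (@fock_coeffs_le _ (fun k => 2 * energy alpha k + 2 * energy beta k)).
  move=> k; apply: le_trans (ler_wpM2l (ltW (fact_gt0R k)) (qabs2D _ _)) _.
  by rewrite mulrDr !(mulrCA _ 2).
apply: cvgP (@cvg_seriesD R R^o _ _ _ _).
  exact: cvgP (@cvg_seriesZ R R^o 2 _ ca).
exact: cvgP (@cvg_seriesZ R R^o 2 _ cb).
Qed.

Lemma fock_coeffsZr alpha a : fock_coeffs alpha -> fock_coeffs (fun k => alpha k * a).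
Proof.
move=> ca; apply: (@fock_coeffs_le _ (fun k => qabs a ^+ 2 * energy alpha k)).
  by move=> k; rewrite /energy qabsM2 mulrA mulrC.
exact: cvgP (@cvg_seriesZ R R^o _ _ ca).
Qed.

Lemma fock_coeffsN alpha : fock_coeffs alpha -> fock_coeffs (- alpha).
Proof.
move=> /(@fock_coeffsZr _ (-1)); congr (fock_coeffs _).
by apply/funext => k; rewrite mulrN1.
Qed.

Lemma fock_coeffsB alpha beta :
  fock_coeffs alpha -> fock_coeffs beta -> fock_coeffs (alpha - beta).
Proof. by move=> ca cb; apply: fock_coeffsD => //; exact: fock_coeffsN. Qed.

Lemma energy_single n c :
  energy (single n c) = (fun k => if k == n then n`!%:R * qabs c ^+ 2 else 0).
Proof.
apply/funext => k; rewrite /energy /single; case: eqP => [->//|_].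
by rewrite qabs2E !quat_coordE; ring.
Qed.

Lemma fock_coeffs_single n c : fock_coeffs (single n c).
Proof.
have := @series_single R R^o n (n`!%:R * qabs c ^+ 2).
by rewrite -energy_single => /cvgP.
Qed.

Lemma fock_coeffs0 : fock_coeffs (0 : nat -> quat R).
Proof.
have := @fock_coeffs_single 0%N 0; congr (fock_coeffs _).
by apply/funext => k; rewrite /single; case: eqP.
Qed.

(** The Taylor bound of Q_k on the ball of radius r. *)
Definition weight (r : R) (k : nat) : R := 2 * (12 * r) ^+ k.

(** A weighted form of the inequality between the arithmetic and geometric
means, applied with F = k!: it trades the exponential growth of Q_k against the
factorial weight of the coefficients. *)
Lemma mul_le_energy (M F n : R) : 0 < F -> M * n <= M ^+ 2 / F + F * n ^+ 2.
Proof.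
move=> F0; rewrite -subr_ge0.
have -> : M ^+ 2 / F + F * n ^+ 2 - M * n =
  F * ((M / F - n / 2) ^+ 2 + 3 / 4 * n ^+ 2) by field; rewrite gt_eqF.
by rewrite mulr_ge0 ?(ltW F0) // addr_ge0 ?sqr_ge0 // mulr_ge0 ?sqr_ge0 // divr_ge0.
Qed.

Lemma weight_exp (r : R) k : weight r k ^+ 2 / k`!%:R = 4 * exp_coeff ((12 * r) ^+ 2) k.
Proof.
by rewrite /weight /exp_coeff /= exprMn -exprM mulnC exprM; field; exact: fact_neq0R.
Qed.

Lemma fock_coeffs_weight alpha (r : R) : 1 <= r -> fock_coeffs alpha ->
  cvgn (series (fun k => weight r k * `|alpha k|)).
Proof.
move=> r1 ca; have r0 : 0 <= r by exact: le_trans r1.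
have e0 k : 0 <= exp_coeff ((12 * r) ^+ 2) k by rewrite exp_coeff_ge0 ?sqr_ge0.
apply: (@series_le_cvg _ _
  (fun k => 4 * exp_coeff ((12 * r) ^+ 2) k + energy alpha k)) => [k|k|k|].
- by rewrite /weight !mulr_ge0 ?exprn_ge0 ?mulr_ge0.
- by rewrite addr_ge0 ?energy_ge0 // mulr_ge0.
- apply: le_trans (mul_le_energy _ _ (fact_gt0R k)) _.
  by rewrite weight_exp lerD2l ler_wpM2l // norm_le_qabs.
- apply: cvgP (@cvg_seriesD R R^o _ _ _ ca).
  exact: cvgP (@cvg_seriesZ R R^o _ _ (is_cvg_series_exp_coeff _)).
Qed.

(** * Termwise differentiation *)

Definition weighted_norm (r : R) alpha : R :=
  limn (series (fun k => weight r k * `|alpha k|)).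

Lemma weighted_series (r C : R) alpha (u : nat -> quat R) :
  1 <= r -> fock_coeffs alpha -> (forall k, `|u k| <= weight r k * C) ->
  cvgn (series (fun k => u k * alpha k)) /\
  `|limn (series (fun k => u k * alpha k))| <= 4 * weighted_norm r alpha * C.
Proof.
move=> r1 ca uC; have cw := fock_coeffs_weight r1 ca.
have cb := @cvg_seriesZ R R^o (4 * C) _ cw.
have := @series_dominated R (quat R) (fun k => u k * alpha k) _ _ (cvgP _ cb).
rewrite (cvg_lim _ cb) // mulrAC; apply => k.
apply: le_trans (norm_quatM _ _) _.
rewrite [leRHS]mulrA ler_wpM2r // -!mulrA ler_wpM2l //.
by rewrite mulrC.
Qed.

Lemma fock_series_cvg alpha q : fock_coeffs alpha -> cvgn (fock_series alpha q).
Proof.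
move=> ca; have r1 : 1 <= `|q| + 1 by rewrite lerDr.
apply: (proj1 (@weighted_series _ 1 alpha _ r1 ca _)) => k.
have [] := taylor_bounded_appellQ k r1 (q := q) (v := 0); rewrite ?addr0 ?lerDl //.
by rewrite mulr1.
Qed.

Definition dfock alpha q v : quat R := limn (series (fun k => dappellQ k q v * alpha k)).

Lemma dfock_series_cvg alpha q v : fock_coeffs alpha ->
  cvgn (series (fun k => dappellQ k q v * alpha k)).
Proof.
move=> ca; have r1 : 1 <= `|q| + `|v| + 1 by rewrite lerDr addr_ge0.
apply: (proj1 (@weighted_series _ `|v| alpha _ r1 ca _)) => k.
have [] := taylor_bounded_appellQ k r1 (q := q) (v := v) => //.
  by rewrite -addrA lerDl addr_ge0.
by rewrite (le_trans (ler_normD _ _)) // lerDl.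
Qed.

Lemma cvg_seriesB_mulr alpha (u w : nat -> quat R) :
  cvgn (series (fun k => u k * alpha k)) -> cvgn (series (fun k => w k * alpha k)) ->
  series (fun k => (u k - w k) * alpha k) @ \oo -->
  limn (series (fun k => u k * alpha k)) - limn (series (fun k => w k * alpha k)).
Proof.
move=> cu cw; under eq_fun do rewrite mulrBl; exact: cvg_seriesB.
Qed.

(** Each of the four estimates for Q_k is summed against alpha_k with
[weighted_series]; the sum of the formal differentials is thereby recognized as
the differential of the sum. *)
Lemma taylor_bounded_fock alpha (r : R) : 1 <= r -> fock_coeffs alpha ->
  taylor_bounded r (4 * weighted_norm r alpha) (fock_fun alpha) (dfock alpha).
Proof.
move=> r1 ca q v hq hv.
have t k := taylor_bounded_appellQ k r1 hq hv.
have cq := @fock_series_cvg alpha q ca; have cqv := @fock_series_cvg alpha (q + v) ca.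
have cd := @dfock_series_cvg alpha q v ca.
split.
- rewrite -[leRHS]mulr1; apply: (proj2 (weighted_series r1 ca _)) => k.
  by have [h _ _ _] := t k; rewrite mulr1.
- by apply: (proj2 (weighted_series r1 ca _)) => k; have [] := t k.
- rewrite -(cvg_lim _ (cvg_seriesB_mulr cqv cq)) //.
  by apply: (proj2 (weighted_series r1 ca _)) => k; have [] := t k.
- have cB := cvg_seriesB_mulr cqv cq; have := cvg_seriesB_mulr (cvgP _ cB) cd.
  rewrite (cvg_lim _ cB) // => /cvg_lim <- //.
  by apply: (proj2 (weighted_series r1 ca _)) => k; have [] := t k.
Qed.

Lemma dfock_linear alpha q : fock_coeffs alpha -> linear (dfock alpha q).
Proof.
move=> ca a u v; have cd := fun v => @dfock_series_cvg alpha q v ca.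
have cZ := @cvg_seriesZ R (quat R) a _ (cd u).
have := cvg_seriesD (cvgP _ cZ) (cd v).
rewrite (cvg_lim _ cZ) // => /cvg_lim <- //; congr (limn (series _)).
by apply/funext => k; rewrite dappellQ_linear mulrDl -scalerAl.
Qed.

Lemma fueter_dfock alpha q : fock_coeffs alpha -> fueter_symbol (dfock alpha q) = 0.
Proof.
move=> ca; have h c e := @cvg_series_mull R _ c (@dfock_series_cvg alpha q e ca).
rewrite /fueter_symbol -[dfock alpha q 1]mul1r.
have := cvgD (cvgD (cvgD (h 1 1) (h (qi R) (qi R))) (h (qj R) (qj R))) (h (qk R) (qk R)).
move=> /(_ _ _ _)/cvg_lim <- //; apply: lim_near_cst => //; apply: nearW => n.
rewrite !fctE /series /= -!big_split /= big1 // => k _.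
by rewrite mul1r !mulrA -!mulrDl -/(fueter_symbol (dappellQ k q)) fueter_dappellQ mul0r.
Qed.

Lemma fock_regular alpha : fock_coeffs alpha -> fueter_regular (fock_fun alpha).
Proof.
move=> ca; apply: (@taylor_bounded_fueter R _ (dfock alpha)) => [r r1|q|q].
- by exists (4 * weighted_norm r alpha); exact: taylor_bounded_fock.
- exact: dfock_linear.
- exact: fueter_dfock.
Qed.

(** * Sums of Appell series *)

Lemma fock_funD alpha beta : fock_coeffs alpha -> fock_coeffs beta ->
  fock_fun (alpha + beta) = fock_fun alpha + fock_fun beta.
Proof.
move=> ca cb; apply/funext => q; apply: cvg_lim => //.
have := cvg_seriesD (@fock_series_cvg alpha q ca) (@fock_series_cvg beta q cb).
by under eq_fun do rewrite -mulrDr.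
Qed.

Lemma fock_funZr alpha a : fock_coeffs alpha ->
  fock_fun (fun k => alpha k * a) = fun_rscale (fock_fun alpha) a.
Proof.
move=> ca; apply/funext => q; apply: cvg_lim => //.
have := @cvg_series_mulr R _ a (@fock_series_cvg alpha q ca).
by under eq_fun do rewrite -mulrA.
Qed.

Lemma fock_funN alpha : fock_coeffs alpha -> fock_fun (- alpha) = - fock_fun alpha.
Proof.
move=> ca; have -> : - alpha = (fun k => alpha k * -1).
  by apply/funext => k; rewrite mulrN1.
by rewrite fock_funZr //; apply/funext => q; rewrite /fun_rscale mulrN1.
Qed.

Lemma fock_funB alpha beta : fock_coeffs alpha -> fock_coeffs beta ->
  fock_fun (alpha - beta) = fock_fun alpha - fock_fun beta.
Proof.
move=> ca cb; rewrite fock_funD ?fock_funN //; exact: fock_coeffsN.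
Qed.

Lemma fock_fun0 : fock_fun (0 : nat -> quat R) = 0.
Proof. by have := fock_funB fock_coeffs0 fock_coeffs0; rewrite !subrr. Qed.

Lemma fock_fun_single n c : fock_fun (single n c) = fun q => appellQ n q * c.
Proof.
apply/funext => q; apply: cvg_lim => //.
have := @series_single R (quat R) n (appellQ n q * c).
rewrite (_ : (fun k => _) = fun k => appellQ k q * single n c k) //.
by apply/funext => k; rewrite /single; case: eqP => [->|_]; rewrite ?mulr0.
Qed.

(** By strong induction on n: if the coefficients of index less than n vanish,
restricting to a real x in (0, 1] gives |x^n alpha_n| <= x^(n+1) B with B
independent of x, hence alpha_n = 0. *)
Lemma fock_fun_eq0 alpha : fock_coeffs alpha -> fock_fun alpha = 0 -> alpha = 0.
Proof.
move=> ca f0; apply/funext => n; elim/ltn_ind: n => n IH.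
have cw := @fock_coeffs_weight alpha 1 (lexx 1) ca.
pose B := weighted_norm 1 alpha.
have w1 k : `|alpha k| <= weight 1 k * `|alpha k|.
  rewrite ler_peMl // /weight mulr1.
  by rewrite (le_trans _ (ler_peMl _ (ler1n R 2))) ?exprn_ege1 ?exprn_ge0 ?ler1n.
have small (x : R) : 0 < x -> x <= 1 -> `|alpha n| <= x * B.
  move=> x0 x1; have xn0 : 0 < x ^+ n by exact: exprn_gt0.
  suff : x ^+ n * `|alpha n| <= x ^+ n.+1 * B by rewrite exprSr -mulrA ler_pM2l.
  have cs : series (fun k => x ^+ k *: alpha k) @ \oo --> (0 : quat R).
    have := @fock_series_cvg alpha x%:A ca.
    rewrite /fock_series -/(fock_fun alpha x%:A) f0.
    by under eq_fun do rewrite appellQ_real -scalerAl mul1r.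
  have c1 := @series_single R (quat R) n (x ^+ n *: alpha n).
  have := cvg_seriesB (cvgP _ cs) (cvgP _ c1).
  rewrite (cvg_lim _ cs) // (cvg_lim _ c1) // sub0r => cu.
  have cb := @cvg_seriesZ R R^o (x ^+ n.+1) _ cw.
  (* the series at x without its n-th term *)
  pose u k := x ^+ k *: alpha k - (if k == n then x ^+ n *: alpha n else 0).
  have := @series_dominated R (quat R) u _ _ (cvgP _ cb).
  rewrite (cvg_lim _ cb) // (cvg_lim _ cu) // normrN normrZ gtr0_norm // => h.
  apply: (proj2 (h _)) => k; rewrite /u.
  have pos : 0 <= x ^+ n.+1 * (weight 1 k * `|alpha k|).
    by rewrite !mulr_ge0 ?exprn_ge0 ?(ltW x0).
  have [e|/= kn] := eqVneq k n; first by rewrite [in leLHS]e subrr normr0.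
  rewrite subr0; have [lt_kn|nk] := ltnP k n; first by rewrite [in leLHS]IH // scaler0 normr0.
  rewrite normrZ ger0_norm ?exprn_ge0 ?(ltW x0) // ler_pM ?exprn_ge0 ?(ltW x0) //.
  by rewrite ler_wiXn2l ?(ltW x0) // ltn_neqAle eq_sym kn.
apply/eqP; rewrite -normr_le0 leNgt; apply/negP => a0.
have aB : `|alpha n| <= B by rewrite -[B]mul1r small.
have B0 : 0 < B by exact: lt_le_trans aB.
have := small (`|alpha n| / (2 * B)); rewrite divr_gt0 ?mulr_gt0 // ler_pdivrMr ?mulr_gt0 //.
have -> : `|alpha n| / (2 * B) * B = `|alpha n| / 2 by field; rewrite gt_eqF.
by move=> /(_ isT); rewrite mul1r; lra.
Qed.

Lemma fock_fun_inj alpha beta : fock_coeffs alpha -> fock_coeffs beta ->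
  fock_fun alpha = fock_fun beta -> alpha = beta.
Proof.
move=> ca cb e; apply/eqP; rewrite -subr_eq0; apply/eqP.
by apply: fock_fun_eq0; rewrite ?fock_funB ?e ?subrr //; exact: fock_coeffsB.
Qed.

Lemma fock_coefK alpha : fock_coeffs alpha -> fock_coef (fock_fun alpha) = alpha.
Proof.
move=> ca; rewrite /fock_coef; case: xgetP => [beta _ [cb e]|/(_ alpha)[]] //.
exact: fock_fun_inj.
Qed.

Lemma fock_coefP (f : quat R -> quat R) :
  fock f -> fock_coeffs (fock_coef f) /\ fock_fun (fock_coef f) = f.
Proof. by case=> alpha ca <-; rewrite fock_coefK. Qed.

(** * The scalar product on coefficients *)

Lemma fock_ipE alpha beta : fock_coeffs alpha -> fock_coeffs beta ->
  fock_ip (fock_fun alpha) (fock_fun beta) = coef_ip alpha beta.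
Proof. by move=> ca cb; rewrite /fock_ip !fock_coefK. Qed.

Lemma fock_ip_series_cvg alpha beta : fock_coeffs alpha -> fock_coeffs beta ->
  cvgn (fock_ip_series alpha beta).
Proof.
move=> ca cb.
have cs := @cvg_seriesD R R^o _ _ (cvgP _ (@cvg_seriesZ R R^o 4 _ ca))
  (cvgP _ (@cvg_seriesZ R R^o 4 _ cb)).
apply: (proj1 (@series_dominated R (quat R) _ _ _ (cvgP _ cs))) => k.
have -> : 4 * energy alpha k + 4 * energy beta k =
    k`!%:R * (4 * (qabs (alpha k) ^+ 2 + qabs (beta k) ^+ 2)).
  by rewrite /energy; ring.
rewrite normrZ ger0_norm // ler_wpM2l //.
apply: le_trans (norm_quatM _ _) _; rewrite -mulrA ler_wpM2l //.
apply: (@le_trans _ _ (`|alpha k| * `|beta k|)); first by rewrite ler_wpM2r ?norm_qconj.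
have := (norm_le_qabs (alpha k), norm_le_qabs (beta k)) => -[].
have : 0 <= (`|alpha k| - `|beta k|) ^+ 2 by exact: sqr_ge0.
have := sqr_ge0 `|alpha k|; have := sqr_ge0 `|beta k|; rewrite sqrrB; lra.
Qed.

Lemma coef_ipD alpha beta gamma :
  fock_coeffs alpha -> fock_coeffs beta -> fock_coeffs gamma ->
  coef_ip alpha (beta + gamma) = coef_ip alpha beta + coef_ip alpha gamma.
Proof.
move=> ca cb cc; apply: cvg_lim => //.
have := cvg_seriesD (@fock_ip_series_cvg alpha beta ca cb)
  (@fock_ip_series_cvg alpha gamma ca cc).
by under eq_fun do rewrite -scalerDr -mulrDr.
Qed.

Lemma coef_ipZ alpha beta a : fock_coeffs alpha -> fock_coeffs beta ->
  coef_ip alpha (fun k => beta k * a) = coef_ip alpha beta * a.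
Proof.
move=> ca cb; apply: cvg_lim => //.
have := @cvg_series_mulr R _ a (@fock_ip_series_cvg alpha beta ca cb).
by under eq_fun do rewrite -scalerAl -mulrA.
Qed.

Lemma coef_ip_conj alpha beta : fock_coeffs alpha -> fock_coeffs beta ->
  coef_ip beta alpha = qconj (coef_ip alpha beta).
Proof.
move=> ca cb; apply: cvg_lim => //.
have := cvg_series_qconj (@fock_ip_series_cvg alpha beta ca cb).
by under eq_fun do rewrite qconjZ qconjM qconjK.
Qed.

Lemma coef_ip_coef_norm2 alpha : fock_coeffs alpha ->
  qc0 (coef_ip alpha alpha) = coef_norm2 alpha.
Proof.
move=> ca; apply/esym/cvg_lim => //.
have := cvg_series_qc0 (@fock_ip_series_cvg alpha alpha ca ca).
by under eq_fun do rewrite quat_coordZ qabs2_conj.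
Qed.

Lemma ip_norm_fock alpha : fock_coeffs alpha ->
  ip_norm (@fock_ip R) (fock_fun alpha) = Num.sqrt (coef_norm2 alpha).
Proof. by move=> ca; rewrite /ip_norm fock_ipE // coef_ip_coef_norm2. Qed.

Lemma coef_ip_eq0 alpha : fock_coeffs alpha -> coef_ip alpha alpha = 0 -> alpha = 0.
Proof.
by move=> ca h; apply: coef_norm2_eq0 => //; rewrite -coef_ip_coef_norm2 // h quat_coord0.
Qed.

Lemma coef_ip_single n c beta : coef_ip (single n c) beta = n`!%:R *: (qconj c * beta n).
Proof.
apply: cvg_lim => //.
have := @series_single R (quat R) n (n`!%:R *: (qconj c * beta n)).
rewrite (_ : (fun k => _) = fun k => k`!%:R *: (qconj (single n c k) * beta k)) //.
apply/funext => k; rewrite /single; case: eqP => [->//|_].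
by rewrite qconj0 mul0r scaler0.
Qed.

(** * Completeness *)

(** As for l^2: since k! >= 1, the k-th coefficients form a Cauchy sequence for
each k; finite partial sums pass to the coefficientwise limit, so the Cauchy
estimates hold against the limit as well. *)
Lemma fock_complete (a : nat -> nat -> quat R) : (forall n, fock_coeffs (a n)) ->
  (forall e : R, 0 < e -> exists N, forall m n, (N <= m)%N -> (N <= n)%N ->
    coef_norm2 (a m - a n) < e ^+ 2) ->
  exists2 l, fock_coeffs l & forall e : R, 0 < e ->
    exists N, forall n, (N <= n)%N ->
      fock_coeffs (a n - l) /\ coef_norm2 (a n - l) <= e ^+ 2.
Proof.
move=> ca cauchy_a.
have ck k : cvgn (fun n => a n k).
  apply: cauchy_cvg; apply: cauchy_exP => e e0.
  have [N hN] := cauchy_a e e0; exists (a N k); exists N => // m /= Nm.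
  rewrite -ball_normE /=; rewrite -(@ltr_pXn2r _ 2) ?nnegrE ?(ltW e0) //.
  apply: le_lt_trans (hN N m (leqnn N) Nm).
  apply: le_trans (energy_le_coef_norm2 k (fock_coeffsB (ca N) (ca m))).
  apply: le_trans (norm_le_qabs _) _.
  by rewrite ler_peMl ?sqr_ge0 // ler1n fact_gt0.
pose l k := limn (fun n => a n k).
have tail_le (e : R) N :
    (forall m n, (N <= m)%N -> (N <= n)%N -> coef_norm2 (a m - a n) < e ^+ 2) ->
    forall n, (N <= n)%N -> fock_coeffs (a n - l) /\ coef_norm2 (a n - l) <= e ^+ 2.
  move=> hN n Nn; apply: series_ge0_bounded => [k|K]; first exact: energy_ge0.
  have : (fun m => series (energy (a n - a m)) K) @ \oo --> series (energy (a n - l)) K.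
    elim: K => [|K IHK].
      by rewrite /series /= big_nil; under eq_fun do rewrite big_nil; exact: cvg_cst.
    rewrite seriesSr; under eq_fun do rewrite seriesSr.
    apply: cvgD => //; apply: cvgM; first exact: cvg_cst.
    by apply: cvg_qabs2; apply: cvgB; [exact: cvg_cst|exact: ck].
  move=> cK; apply: (cvgr_to_le cK); exists N => // m /= Nm.
  apply: le_trans (ltW (hN n m Nn Nm)).
  by apply: series_ge0_le_lim; [exact: energy_ge0|exact: fock_coeffsB].
have cl : fock_coeffs l.
  have [N hN] := cauchy_a 1 ltr01.
  have [cd _] := tail_le _ _ hN N (leqnn N).
  by have := fock_coeffsB (ca N) cd; rewrite opprB addrC subrK.
exists l => // e /cauchy_a[N hN]; exists N; exact: tail_le.
Qed.

Lemma fock_hilbert : right_hilbert (@fun_rscale R) (@fock_ip R) (@fock R).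
Proof.
split.
- by exists 0; [exact: fock_coeffs0|exact: fock_fun0].
- move=> _ _ [a ca <-] [b cb <-].
  by exists (a + b); [exact: fock_coeffsD|exact: fock_funD].
- by move=> _ [a ca <-]; exists (- a); [exact: fock_coeffsN|exact: fock_funN].
- move=> _ c [a ca <-].
  by exists (fun k => a k * c); [exact: fock_coeffsZr|exact: fock_funZr].
- by move=> f _; apply/funext => q; rewrite /fun_rscale mulr1.
- by move=> f a b _; apply/funext => q; rewrite /fun_rscale mulrA.
- by move=> f g a _ _; apply/funext => q; rewrite /fun_rscale -mulrDl.
- by move=> f a b _; apply/funext => q; rewrite /fun_rscale mulrDr.
- move=> _ _ _ [a ca <-] [b cb <-] [c cc <-].
  have cbc := fock_coeffsD cb cc.
  by rewrite -fock_funD // !fock_ipE // coef_ipD.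
- move=> _ _ c [a ca <-] [b cb <-]; have cbc := @fock_coeffsZr _ c cb.
  by rewrite -fock_funZr // !fock_ipE // coef_ipZ.
- by move=> _ _ [a ca <-] [b cb <-]; rewrite !fock_ipE // coef_ip_conj.
- by move=> _ [a ca <-]; rewrite fock_ipE // coef_ip_coef_norm2 // coef_norm2_ge0.
- move=> _ [a ca <-]; rewrite fock_ipE // => /(coef_ip_eq0 ca) ->.
  exact: fock_fun0.
- move=> u hu cauchy_u; pose a n := fock_coef (u n).
  have ca n : fock_coeffs (a n) by have [] := fock_coefP (hu n).
  have ua n : u n = fock_fun (a n) by have [] := fock_coefP (hu n).
  have [|l cl hl] := fock_complete ca.
    move=> e e0; have [N hN] := cauchy_u e e0; exists N => m n Nm Nn.
    have cd := fock_coeffsB (ca m) (ca n).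
    have := hN m n Nm Nn; rewrite !ua -fock_funB // ip_norm_fock // => h.
    by rewrite -(sqr_sqrtr (coef_norm2_ge0 cd)) ltr_pXn2r ?nnegrE ?sqrtr_ge0 ?(ltW e0).
  exists (fock_fun l); first by exists l.
  apply/cvgrPdist_le => e e0; have [N hN] := hl e e0; exists N => // n /= Nn.
  have [cd dn] := hN n Nn.
  rewrite sub0r normrN ger0_norm ?sqrtr_ge0 // ua -fock_funB // ip_norm_fock //.
  by rewrite -[leRHS](ger0_norm (ltW e0)) -sqrtr_sqr ler_wsqrtr.
Qed.

(** * The reproducing kernel *)

Lemma fock_coeffs_kernel p : fock_coeffs (kernel_coef p).
Proof.
have r1 : 1 <= `|p| + 1 by rewrite lerDr.
have pr : `|p| <= `|p| + 1 by rewrite lerDl.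
apply: (@fock_coeffs_le _ (fun k => 4 * (4 * exp_coeff ((12 * (`|p| + 1)) ^+ 2) k))).
  move=> k; have [|h _ _ _] := taylor_bounded_appellQ k r1 (v := 0) pr.
    by rewrite addr0.
  rewrite -weight_exp /energy qabsZ2 qabs_conj2.
  apply: (@le_trans _ _ (qabs (appellQ k p) ^+ 2 / k`!%:R)).
    by rewrite le_eqVlt; apply/orP; left; apply/eqP; field; exact: fact_neq0R.
  rewrite mulrA ler_wpM2r ?invr_ge0 //; apply: le_trans (qabs2_le_norm _) _.
  by rewrite ler_wpM2l // ler_sqr ?nnegrE // (le_trans _ h).
apply: cvgP (@cvg_seriesZ R R^o _ _ _); apply: cvgP (@cvg_seriesZ R R^o _ _ _).
exact: is_cvg_series_exp_coeff.
Qed.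

Lemma fock_kernel_seriesE q p :
  fock_kernel_series q p = fock_series (kernel_coef p) q.
Proof.
by rewrite /fock_kernel_series; under eq_fun do rewrite scalerAr.
Qed.

Lemma fock_kernelE p : (@fock_kernel R)^~ p = fock_fun (kernel_coef p).
Proof. by apply/funext => q; rewrite /fock_kernel fock_kernel_seriesE. Qed.

Lemma coef_ip_kernel p alpha : coef_ip (kernel_coef p) alpha = fock_fun alpha p.
Proof.
rewrite /coef_ip /fock_ip_series /fock_fun /fock_series; congr (limn (series _)).
apply/funext => k; rewrite /kernel_coef qconjZ qconjK -scalerAl scalerA.
by rewrite divff ?scale1r // fact_neq0R.
Qed.

Lemma fock_kernel_reproducing :
  reproducing_kernel (@fock_ip R) (@fock R) (@fock_kernel R).
Proof.
split=> [p|_ p [a ca <-]]; rewrite fock_kernelE.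
  by exists (kernel_coef p) => //; exact: fock_coeffs_kernel.
by rewrite fock_ipE ?coef_ip_kernel //; exact: fock_coeffs_kernel.
Qed.

(** Both K(., p) and K'(., p) represent evaluation at p, so their difference is
orthogonal to the whole space, in particular to itself. *)
Lemma right_hilbert_kernel_unique (T : Type) rscale
    (ip : (T -> quat R) -> (T -> quat R) -> quat R) H K K' :
  right_hilbert rscale ip H ->
  reproducing_kernel ip H K -> reproducing_kernel ip H K' -> K = K'.
Proof.
move=> hH [HK rK] [HK' rK']; apply/funext => q; apply/funext => p.
suff e : K^~ p - K'^~ p = 0 by apply/eqP; rewrite -subr_eq0 -[0]/((0 : T -> quat R) q) -e.
have HN := rh_opp hH (HK' p); have HD := rh_add hH (HK p) HN.
apply: (rh_ip_eq0 hH HD).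
have ipDl f g h : H f -> H g -> H h -> ip (f + g) h = ip f h + ip g h.
  move=> Hf Hg Hh; have Hfg := rh_add hH Hf Hg.
  rewrite (rh_ip_conj hH Hh Hfg) (rh_ip_conj hH Hh Hf) (rh_ip_conj hH Hh Hg).
  by rewrite (rh_ipD hH) // qconjD.
apply: (addIr (ip (K'^~ p) (K^~ p - K'^~ p))).
by rewrite -ipDl // subrK add0r rK // rK'.
Qed.

(** * The orthonormal basis *)

Definition psi_coef (n : nat) : quat R := ((Num.sqrt n`!%:R)^-1 : R)%:A.

Lemma fock_psiE n : @fock_psi R n = fock_fun (single n (psi_coef n)).
Proof.
rewrite fock_fun_single; apply/funext => q.
by rewrite /fock_psi /psi_coef -scalerAr mulr1.
Qed.

Lemma sqrt_fact_neq0 n : Num.sqrt n`!%:R != 0 :> R.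
Proof. by rewrite gt_eqF // sqrtr_gt0 fact_gt0R. Qed.

Lemma fock_ip_psi n alpha : fock_coeffs alpha ->
  fock_ip (@fock_psi R n) (fock_fun alpha) = Num.sqrt n`!%:R *: alpha n.
Proof.
move=> ca; rewrite fock_psiE fock_ipE //; last exact: fock_coeffs_single.
rewrite coef_ip_single /psi_coef qconjZ [qconj 1](_ : _ = 1); last quat_ring.
rewrite -scalerAl mul1r scalerA; congr (_ *: _).
rewrite -{1}(sqr_sqrtr (ltW (fact_gt0R n))) expr2 mulfK //.
Qed.

Lemma fock_psi_orthonormal m n :
  fock_ip (@fock_psi R m) (@fock_psi R n) = (m == n)%:R.
Proof.
rewrite [@fock_psi R n]fock_psiE fock_ip_psi; last exact: fock_coeffs_single.
rewrite /single; case: eqP => [->|_]; last by rewrite scaler0.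
by rewrite /psi_coef scalerA divff ?scale1r // sqrt_fact_neq0.
Qed.

Definition trunc n alpha : nat -> quat R := fun k => if (k < n)%N then alpha k else 0.

Lemma truncS n alpha : trunc n.+1 alpha = trunc n alpha + single n (alpha n).
Proof.
have addE (a b : nat -> quat R) k : (a + b) k = a k + b k by [].
apply/funext => k; rewrite addE /trunc /single.
rewrite ltnS leq_eqVlt; case: eqP => [->|_] /=; first by rewrite ltnn /= add0r.
by rewrite addr0.
Qed.

Lemma fock_trunc n alpha : fock_coeffs alpha -> fock_coeffs (trunc n alpha) /\
  \sum_(0 <= k < n) fun_rscale (@fock_psi R k) (fock_ip (@fock_psi R k) (fock_fun alpha))
    = fock_fun (trunc n alpha).
Proof.
move=> ca; elim: n => [|n [cn IH]].
  have -> : trunc 0 alpha = 0 by [].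
  split; first exact: fock_coeffs0.
  by rewrite big_nil fock_fun0.
have cs := @fock_coeffs_single n (alpha n).
rewrite truncS; split; first exact: fock_coeffsD.
rewrite big_nat_recr //= IH fock_funD //; congr (_ + _).
rewrite fock_ip_psi // fock_fun_single; apply/funext => q.
rewrite /fun_rscale /fock_psi -scalerAl -scalerAr scalerA mulVf ?scale1r //.
Qed.

Lemma coef_norm2_tail n alpha : fock_coeffs alpha ->
  coef_norm2 (alpha - trunc n alpha) = coef_norm2 alpha - series (energy alpha) n.
Proof.
move=> ca; apply: cvg_lim => //.
have : (fun N => series (energy alpha) N - series (energy alpha) n) @ \oo -->
    coef_norm2 alpha - series (energy alpha) n.
  by apply: cvgB; [exact: ca|exact: cvg_cst].
apply: cvg_trans; apply: near_eq_cvg; exists n => // N /= nN.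
have subE (a b : nat -> quat R) k : (a - b) k = a k - b k by [].
rewrite sub_series_geq // /series /= [RHS](@big_cat_nat _ _ _ n) //= [X in _ = X + _]big_nat.
rewrite [X in _ = X + _]big1 ?add0r => [|k /andP[_ kn]].
  apply: eq_big_nat => k /andP[nk _].
  by rewrite /energy subE /trunc ltnNge nk subr0.
by rewrite /energy subE /trunc kn subrr qabs2E !quat_coord0 !expr0n !addr0 mulr0.
Qed.

Lemma fock_basis : orthonormal_basis (@fun_rscale R) (@fock_ip R) (@fock R) (@fock_psi R).
Proof.
split=> [n|m n|_ [a ca <-]].
- by rewrite fock_psiE; exists (single n (psi_coef n)) => //; exact: fock_coeffs_single.
- exact: fock_psi_orthonormal.
- have E n : ip_norm (@fock_ip R) (fock_fun a - \sum_(0 <= k < n)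
      fun_rscale (@fock_psi R k) (fock_ip (@fock_psi R k) (fock_fun a))) =
      Num.sqrt (coef_norm2 a - series (energy a) n).
    have [ct ->] := fock_trunc n ca.
    by rewrite -fock_funB // ip_norm_fock ?coef_norm2_tail //; exact: fock_coeffsB.
  under eq_fun do rewrite E.
  have c0 : (fun n => coef_norm2 a - series (energy a) n) @ \oo --> (0 : R).
    by rewrite -(subrr (coef_norm2 a)); apply: cvgB; [exact: cvg_cst|exact: ca].
  by have := cvg_comp _ _ c0 (@sqrt_continuous R 0); rewrite sqrtr0; apply.
Qed.

End Coefficients.

Theorem theorem4p2 (R : realType) :
  (* the elements of the space and their scalar product are well defined *)
  [/\ forall alpha : nat -> quat R, fock_coeffs alpha ->
        forall q : quat R, cvgn (fock_series alpha q),
      forall alpha beta : nat -> quat R,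
        fock_coeffs alpha -> fock_coeffs beta ->
        fock_fun alpha = fock_fun beta -> alpha = beta
    & forall alpha beta : nat -> quat R,
        fock_coeffs alpha -> fock_coeffs beta ->
        cvgn (fock_ip_series alpha beta)] /\
  [/\ right_hilbert (@fun_rscale R) (@fock_ip R) (@fock R),
      forall f : quat R -> quat R, fock f -> fueter_regular f,
      forall q p : quat R, cvgn (fock_kernel_series q p),
      forall K : quat R -> quat R -> quat R,
        reproducing_kernel (@fock_ip R) (@fock R) K <-> K = @fock_kernel R
    & orthonormal_basis (@fun_rscale R) (@fock_ip R) (@fock R) (@fock_psi R)].
Proof.
split; split.
- by move=> alpha ca q; exact: fock_series_cvg.
- exact: fock_fun_inj.
- exact: fock_ip_series_cvg.
- exact: fock_hilbert.
- by move=> _ [alpha ca <-]; exact: fock_regular.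
- by move=> q p; rewrite fock_kernel_seriesE;
  apply: fock_series_cvg; exact: fock_coeffs_kernel.
- move=> K; split=> [hK|->]; last exact: fock_kernel_reproducing.
  exact: (right_hilbert_kernel_unique (fock_hilbert R) hK (fock_kernel_reproducing R)).
- exact: fock_basis.
Qed.
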